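(* Let $f$ be a real homogeneous polynomial of degree $n$ in the two variables $(x^1,x^2)$ and let $P\subset\mathbb{R}^3$ be its graph $x^3=f(x^1,x^2)$. Then $P$ has a finite, even number of umbilic points at infinity (that is, the set of $A\in[0,2\pi)$ at which $P$ has an umbilic at infinity is finite and has an even number of elements), and this number is no more than $6n-8$.
   Context: Write $z=x^1+ix^2$ for the complex coordinate on the domain $\mathbb{R}^2$, and let $\kappa_1,\kappa_2$ be the principal curvatures of $P$, regarded as functions of $z$ (at the point of $P$ lying over $z$). Gauss map. Let $\xi$ be the holomorphic (stereographic) coordinate about the North pole of $\mathbb{S}^2$, for which the unit vector corresponding to $\xi$ has components $\frac{2\xi}{1+\xi\bar\xi}\in\mathbb{C}\cong\mathbb{R}^2$ and $\frac{1-\xi\bar\xi}{1+\xi\bar\xi}\in\mathbb{R}$. The upward unit normal of $P$ at the point over $z$ has coordinate $\xi=\xi(z,\bar z)$ with $|\xi|<1$ and $\frac{\xi}{1-\xi\bar\xi}=-\partial_{\bar z}f$. Distance to infinity. $d_\infty=1-|\xi|$, a positive function on $P$. Umbilic at infinity. $P$ has an umbilic at infinity at $A\in[0,2\pi)$ if $\lim_{R\to\infty}\left.\frac{|\kappa_1-\kappa_2|}{d_\infty}\right|_{z=Re^{iA}}=0$ (the limit exists and equals $0$).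
   Formalization: The formal theorem additionally assumes that f is not of the form c(ax^1+bx^2)^n (which excludes f=0 and n≤1); for every such f the claim fails, since infinitely many A are umbilic at infinity, e.g. f=(x^1)^2. *)

(* Defs.v *)
From HB Require Import structures.
From mathcomp Require Import all_boot all_order all_algebra.
From mathcomp Require Import all_classical all_reals all_analysis.
From mathcomp Require Import complex.
(* The notations of mpoly clash with those of analysis. *)
From mathcomp Require Import -(notations) mpoly.
From mathcomp Require Import ring lra.

Set Implicit Arguments.
Unset Strict Implicit.
Unset Printing Implicit Defensive.

Import Order.TTheory GRing.Theory Num.Theory.
Import numFieldNormedType.Exports.

Local Open Scope classical_set_scope.
Local Open Scope ring_scope.

Section Graph.
Context {R : realType}.
Implicit Types (f : 'rV[R]_2 -> R) (x : 'rV[R]_2) (k : R) (xi : R[i]).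

Definition poly_fun (p : mpoly 2 R) : 'rV[R]_2 -> R :=
  fun x => meval (fun i => x 0 i) p.

Definition partial f (i : 'I_2) : 'rV[R]_2 -> R :=
  fun x => 'D_(delta_mx 0 i) f x.

Definition grad f x : 'rV[R]_2 := \row_i partial f i x.

Definition hess f x : 'M[R]_2 := \matrix_(i, j) partial (partial f j) i x.

Definition area_density f x : R :=
  Num.sqrt (1 + partial f 0 x ^+ 2 + partial f 1 x ^+ 2).

(* Components in C and R of the upward unit normal of the graph of f, the   *)
(* horizontal R^2 being identified with C.                                  *)
Definition normal_hor f x : R[i] :=
  (- partial f 0 x / area_density f x +i* (- partial f 1 x / area_density f x))%C.
Definition normal_ver f x : R := (area_density f x)^-1.

(* Fundamental forms of the graph of f in the coordinates (x^1, x^2), the   *)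
(* second one with respect to the upward normal.                            *)
Definition first_form f x : 'M[R]_2 := 1%:M + (grad f x)^T *m grad f x.
Definition second_form f x : 'M[R]_2 := (area_density f x)^-1 *: hess f x.

Definition shape_operator f x : 'M[R]_2 :=
  invmx (first_form f x) *m second_form f x.

(* k1 and k2 are the eigenvalues of the shape operator, with multiplicity.  *)
Definition principal_curvatures f x k1 k2 : Prop :=
  char_poly (shape_operator f x) = ('X - k1%:P) * ('X - k2%:P).

(* xi is the stereographic coordinate of the upward unit normal.            *)
Definition gauss_coordinate f x xi : Prop :=
  2 * xi / (1 + xi * xi^*) = normal_hor f x /\
  (1 - xi * xi^*) / (1 + xi * xi^*) = (normal_ver f x)%:C%C.

Definition dzbar f x : R[i] := (partial f 0 x +i* partial f 1 x)%C / 2.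

Definition dist_infty xi : R := 1 - ComplexField.Normc.normc xi.

Definition polar (r A : R) : 'rV[R]_2 :=
  \row_i if i == 0 then r * cos A else r * sin A.

Definition umbilic_at_infinity (k1 k2 : 'rV[R]_2 -> R) (xi : 'rV[R]_2 -> R[i])
    (A : R) : Prop :=
  `|k1 (polar r A) - k2 (polar r A)| / dist_infty (xi (polar r A))
    @[r --> +oo] --> 0.

(* The degenerate forms c * (a x^1 + b x^2)^n, which include every form of  *)
(* degree n <= 1 and the zero form. These are the forms with identically    *)
(* vanishing Hessian determinant (their graphs are planes or cylinders),    *)
(* and exactly those for which infinitely many directions are umbilic: for  *)
(* f = (x^1)^2, all directions except +-pi/2.                               *)
Definition power_of_linear_form (n : nat) f : Prop :=
  exists c a b : R, forall x, f x = c * (a * x 0 0 + b * x 0 1) ^+ n.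

Let good (i : 'I_2) (p : mpoly 2 R) := forall x,
  is_derive x (delta_mx 0 i) (poly_fun p) (poly_fun (mderiv i p) x).

Let good_XU i j : good i (mpolyX R (mnm1 j)).
Proof.
move=> x.
rewrite mderivX /poly_fun mevalZ.
have -> : (fun x0 : 'rV[R]_2 => meval (fun i0 => x0 0 i0) (mpolyX R (mnm1 j))) = (fun x0 => x0 0 j).
  by apply/funext => y; rewrite mevalXU.
have -> : ((mnm1 j i)%:R * meval [eta x 0] (mpolyX R (mnm_sub (mnm1 j) (mnm1 i))))
   = (delta_mx 0 i : 'rV[R]_2) 0 j.
  rewrite mnm1E mxE eqxx /=; case: eqVneq => [->|_]; last by rewrite mul0r.
  have -> : mnm_sub (mnm1 i) (mnm1 i) = mnm0. apply/mnmP => l; rewrite mnmBE subnn mnmE. done.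
  by rewrite mevalX big1 ?mulr1 // => l _; rewrite mnmE expr0.
have lin : linear (fun x0 : 'rV[R]_2 => x0 0 j : R) by move=> a u v; rewrite !mxE.
pose h := GRing.isLinear.Build _ _ _ _ _ lin.
pose g : {linear 'rV[R]_2 -> R} := HB.pack (fun x0 : 'rV[R]_2 => x0 0 j : R) h.
have D : differentiable g x by apply: differentiable_coord.
apply: DeriveDef; first exact: (diff_derivable D).
rewrite (deriveE _ D) diff_lin //.
exact: coord_continuous.
Qed.

Let good_C i c : good i (mpolyC 2 c).
Proof.
move=> x; rewrite mderivC.
have -> : poly_fun (mpolyC 2 c) = cst c by apply/funext => y; rewrite /poly_fun mevalC.
by rewrite /poly_fun meval0; exact: is_derive_cst.
Qed.

Let poly_funD (p q : mpoly 2 R) : poly_fun (p + q) = poly_fun p + poly_fun q.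
Proof. by apply/funext => y; rewrite /poly_fun mevalD. Qed.

Let poly_funM (p q : mpoly 2 R) : poly_fun (p * q) = poly_fun p * poly_fun q.
Proof. by apply/funext => y; rewrite /poly_fun mevalM. Qed.

Let good_D i p q : good i p -> good i q -> good i (p + q).
Proof.
by move=> hp hq x; rewrite mderivD !poly_funD; apply: is_deriveD; [exact: hp | exact: hq].
Qed.

Let good_M i p q : good i p -> good i q -> good i (p * q).
Proof.
move=> hp hq x; rewrite mderivM poly_funD !poly_funM.
apply: is_derive_eq (is_deriveM (hp x) (hq x)) _.
by rewrite /GRing.scale /= addrC [poly_fun q x * _]mulrC.
Qed.

Lemma is_derive_poly_fun (p : mpoly 2 R) i x :
  is_derive x (delta_mx 0 i) (poly_fun p) (poly_fun (mderiv i p) x).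
Proof.
suff: good i p by exact.
elim/mpolyind: p => [|c m p _ _ ih]; first by rewrite -(mpolyC0 2); exact: good_C.
apply: good_D => //; rewrite -mul_mpolyC; apply: good_M; first exact: good_C.
rewrite mpolyXE_id.
elim/big_ind: _ => [||j _].
- rewrite -(mpolyC1 2 R); exact: good_C.
- by move=> u v; exact: good_M.
elim: (m j) => [|l ihl]; first by rewrite expr0 -(mpolyC1 2 R); exact: good_C.
by rewrite exprS; apply: good_M => //; exact: good_XU.
Qed.

Lemma partial_poly_fun (p : mpoly 2 R) i : partial (poly_fun p) i = poly_fun (mderiv i p).
Proof.
by apply/funext => x; apply: derive_val; exact: is_derive_poly_fun.
Qed.

Let Cdiv (a b c : R) : ((a +i* b) / c%:C)%C = (a / c +i* (b / c))%C.
Proof.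
rewrite -fmorphV /=; apply/eqP; rewrite eq_complex /=; apply/andP; split; apply/eqP; ring.
Qed.

Let Cnorm (a b : R) : (a +i* b)%C * (a +i* b)%C^* = (a ^+ 2 + b ^+ 2)%:C%C.
Proof.
by apply/eqP; rewrite eq_complex /=; apply/andP; split; apply/eqP; ring.
Qed.

Let hform (a b : R) : 2 * (a +i* b)%C / (1 + (a +i* b)%C * (a +i* b)%C^*) =
  (2 * a / (1 + (a ^+ 2 + b ^+ 2)) +i* (2 * b / (1 + (a ^+ 2 + b ^+ 2))))%C.
Proof.
rewrite Cnorm.
have -> : 1 + (a ^+ 2 + b ^+ 2)%:C%C = (1 + (a ^+ 2 + b ^+ 2))%:C%C :> R[i] by rewrite [in RHS]rmorphD rmorph1.
have -> : 2 * (a +i* b)%C = (2 * a +i* (2 * b))%C :> R[i].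
  have -> : (2 : R[i]) = 1 + 1 by [].
  by rewrite mulrDl mul1r; apply/eqP; rewrite eq_complex /=; apply/andP; split; apply/eqP; ring.
by rewrite Cdiv.
Qed.

Let eqC (a b c d : R) : (a +i* b)%C = (c +i* d)%C <-> a = c /\ b = d.
Proof. by split => [[-> ->] //|[-> ->]]. Qed.

Let vform (a b : R) : (1 - (a +i* b)%C * (a +i* b)%C^*) / (1 + (a +i* b)%C * (a +i* b)%C^*) =
  ((1 - (a ^+ 2 + b ^+ 2)) / (1 + (a ^+ 2 + b ^+ 2)))%:C%C.
Proof. by rewrite Cnorm !(rmorphB, rmorphD, rmorphM, fmorphV, rmorph1). Qed.

Let gaussE f x (a b : R) : let s := a ^+ 2 + b ^+ 2 in let W := area_density f x in
  gauss_coordinate f x (a +i* b)%C <->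
  [/\ 2 * a / (1 + s) = - partial f 0 x / W, 2 * b / (1 + s) = - partial f 1 x / W
    & (1 - s) / (1 + s) = W^-1].
Proof.
move=> s W; rewrite /gauss_coordinate hform vform /normal_hor /normal_ver eqC eqC.
by split => [[[-> ->] [->]]//|[-> -> ->]].
Qed.

Let dens f x : let W := area_density f x in
  [/\ 0 < W, 1 <= W & W ^+ 2 = 1 + partial f 0 x ^+ 2 + partial f 1 x ^+ 2].
Proof.
have := sqr_ge0 (partial f 0 x); have := sqr_ge0 (partial f 1 x) => h1 h0.
rewrite /area_density /=.
rewrite sqr_sqrtr; last by lra.
rewrite sqrtr_gt0 -[X in X <= _]sqrtr1 ler_sqrt; last by lra.
by split => //; lra.
Qed.

Lemma exists_gauss_coordinate f x : exists xi, gauss_coordinate f x xi.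
Proof.
have [W0 W1 W2] := dens f x.
set W := area_density f x in W0 W1 W2.
exists (- partial f 0 x / (1 + W) +i* (- partial f 1 x / (1 + W)))%C.
apply/gaussE; rewrite -/W.
have W10 : 1 + W != 0 by rewrite gt_eqF //; lra.
have Wn0 : W != 0 by rewrite gt_eqF.
set s := (- partial f 0 x / (1 + W)) ^+ 2 + (- partial f 1 x / (1 + W)) ^+ 2.
have sE : s = (W - 1) / (1 + W).
  have -> : s = (partial f 0 x ^+ 2 + partial f 1 x ^+ 2) / (1 + W) ^+ 2.
    by rewrite /s; field.
  have -> : partial f 0 x ^+ 2 + partial f 1 x ^+ 2 = W ^+ 2 - 1 by rewrite W2; ring.
  by field.
have s1 : 1 + s = 2 * W / (1 + W) by rewrite sE; field.
have s2 : 1 - s = 2 / (1 + W) by rewrite sE; field.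
rewrite s1 s2.
by split; field; rewrite W10 Wn0.
Qed.


Lemma gauss_coordinateP f x xi : gauss_coordinate f x xi <->
  ComplexField.Normc.normc xi < 1 /\ xi / (1 - xi * xi^*) = - dzbar f x.
Proof.
case: xi => a b; rewrite gaussE.
have [W0 W1 W2] := dens f x.
set W := area_density f x in W0 W1 W2 *.
set s := a ^+ 2 + b ^+ 2.
have s0 : 0 <= s by rewrite /s; have := sqr_ge0 a; have := sqr_ge0 b; lra.
have nE : (ComplexField.Normc.normc (a +i* b)%C < 1) = (s < 1).
  by rewrite /= -/s -[X in _ < X]sqrtr1 ltr_sqrt.
have dE : (a +i* b)%C / (1 - (a +i* b)%C * (a +i* b)%C^*) = - dzbar f x <->
   a / (1 - s) = - partial f 0 x / 2 /\ b / (1 - s) = - partial f 1 x / 2.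
  rewrite Cnorm -/s.
  have -> : 1 - s%:C%C = (1 - s)%:C%C :> R[i] by rewrite rmorphB rmorph1.
  rewrite Cdiv /dzbar.
  have -> : (2 : R[i]) = 2%:C%C by rewrite rmorph_nat.
  by rewrite Cdiv [- _]/GRing.opp /= eqC !mulNr.
rewrite nE dE.
have s1 : 1 + s != 0 by rewrite gt_eqF //; lra.
have Wn0 : W != 0 by rewrite gt_eqF.
split => [[h0 h1 h2]|[h0 [h1 h2]]].
  have s2 : 1 - s = (1 + s) / W by rewrite -h2; field.
  have s3 : 0 < 1 - s by rewrite s2 divr_gt0 //; lra.
  have s4 : 1 - s != 0 by rewrite gt_eqF.
  split; first by lra.
  have -> : - partial f 0 x = 2 * a / (1 + s) * W by rewrite h0; field.
  have -> : - partial f 1 x = 2 * b / (1 + s) * W by rewrite h1; field.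
  have -> : W = (1 + s) / (1 - s) by rewrite s2; field; rewrite s1 Wn0.
  by split; field; rewrite s1 s4.
have s4 : 1 - s != 0 by rewrite gt_eqF //; lra.
have p0 : partial f 0 x = - (2 * (a / (1 - s))) by rewrite h1; field.
have p1 : partial f 1 x = - (2 * (b / (1 - s))) by rewrite h2; field.
have WE : W = (1 + s) / (1 - s).
  apply/eqP; rewrite -(@eqrXn2 _ 2) ?W2 //; last 2 first.
  - exact: ltW.
  - by rewrite divr_ge0 //; lra.
  have -> : 1 + partial f 0 x ^+ 2 + partial f 1 x ^+ 2 = 1 + 4 * s / (1 - s) ^+ 2.
    by rewrite p0 p1 /s; field; exact: s4.
  by apply/eqP; field.
rewrite WE p0 p1; split; field; rewrite ?s1 ?s4 //.
Qed.


Let det2 (T : comNzRingType) (A : 'M[T]_2) :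
  \det A = A 0 0 * A 1 1 - A 0 1 * A 1 0.
Proof.
rewrite (expand_det_row _ 0) !big_ord_recl big_ord0 /cofactor !det_mx11 !mxE /=.
have -> : lift 0 0 = 1 :> 'I_2 by exact/val_inj.
have -> : lift 1 0 = 0 :> 'I_2 by exact/val_inj.
by rewrite /= !(expr0, expr1); ring.
Qed.

Let sum2E (F : 'I_2 -> R) : \sum_i F i = F 0 + F 1.
Proof. by rewrite !big_ord_recl big_ord0 addr0; congr (_ + F _); exact/val_inj. Qed.

Let char_poly2 (A : 'M[R]_2) k1 k2 : k1 + k2 = A 0 0 + A 1 1 ->
  k1 * k2 = A 0 0 * A 1 1 - A 0 1 * A 1 0 -> char_poly A = ('X - k1%:P) * ('X - k2%:P).
Proof.
move=> ht hd; rewrite /char_poly det2 /char_poly_mx !mxE /=.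
rewrite !mulr1n !mulr0n !sub0r.
have htP : k1%:P + k2%:P = (A 0 0)%:P + (A 1 1)%:P by rewrite -!polyCD ht.
have hdP : k1%:P * k2%:P = (A 0 0)%:P * (A 1 1)%:P - (A 0 1)%:P * (A 1 0)%:P.
  by rewrite -!polyCM -polyCB hd.
transitivity ('X ^+ 2 - (k1%:P + k2%:P) * 'X + k1%:P * k2%:P); last by ring.
by rewrite htP hdP; ring.
Qed.

Let discr_ge0 (G S H : 'M[R]_2) : G 1 0 = G 0 1 -> H 1 0 = H 0 1 ->
  0 < G 0 0 -> 0 < \det G -> G *m S = H ->
  0 <= (S 0 0 + S 1 1) ^+ 2 - 4 * (S 0 0 * S 1 1 - S 0 1 * S 1 0).
Proof.
move=> symG symH E0 D0 GS.
have e00 : G 0 0 * S 0 0 + G 0 1 * S 1 0 = H 0 0 by rewrite -GS mxE sum2E.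
have e01 : G 0 0 * S 0 1 + G 0 1 * S 1 1 = H 0 1 by rewrite -GS mxE sum2E.
have e10 : G 0 1 * S 0 0 + G 1 1 * S 1 0 = H 0 1.
  by rewrite -symH -GS mxE sum2E symG.
have e11 : G 0 1 * S 0 1 + G 1 1 * S 1 1 = H 1 1.
  by rewrite -GS mxE sum2E symG.
move: D0 E0 e00 e01 e10 e11; rewrite det2 symG -expr2.
move: (G 0 0) (G 0 1) (G 1 1) (S 0 0) (S 0 1) (S 1 0) (S 1 1) (H 0 0) (H 0 1) (H 1 1).
move=> E F K s00 s01 s10 s11 L M N D0 E0 e00 e01 e10 e11.
set t := s00 + s11; set d := s00 * s11 - _.
have tE : t * (E * K - F ^+ 2) = E * N - 2 * F * M + K * L.
  rewrite /t -e00 -e11.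
  transitivity (E * K * s00 + E * K * s11 + E * F * s01 + F * K * s10
    - F * (E * s01 + F * s11) - F * (F * s00 + K * s10)); first by ring.
  by rewrite e01 e10; ring.
have dE : d * (E * K - F ^+ 2) = L * N - M ^+ 2.
  have -> : M ^+ 2 = (E * s01 + F * s11) * (F * s00 + K * s10).
    by rewrite e01 e10.
  by rewrite /d -e00 -e11; ring.
have key : (t ^+ 2 - 4 * d) * (E * K - F ^+ 2) ^+ 2 =
    4 * (E * K - F ^+ 2) * ((E * M - F * L) / E) ^+ 2
    + (E * N - K * L - 2 * F / E * (E * M - F * L)) ^+ 2.
  transitivity ((t * (E * K - F ^+ 2)) ^+ 2
     - 4 * (d * (E * K - F ^+ 2)) * (E * K - F ^+ 2)); first by ring.
  by rewrite tE dE; field; rewrite gt_eqF.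
rewrite -(pmulr_lge0 _ (exprn_gt0 2 D0)) key.
by rewrite addr_ge0 ?sqr_ge0 // mulr_ge0 ?sqr_ge0 // mulr_ge0 ?ler0n // ltW.
Qed.

Let eigen_exists (S : 'M[R]_2) :
  0 <= (S 0 0 + S 1 1) ^+ 2 - 4 * (S 0 0 * S 1 1 - S 0 1 * S 1 0) ->
  exists k1 k2, char_poly S = ('X - k1%:P) * ('X - k2%:P).
Proof.
set t := S 0 0 + S 1 1; set d := _ - S 0 1 * _ => disc.
pose q := Num.sqrt (t ^+ 2 - 4 * d).
have q2 : q ^+ 2 = t ^+ 2 - 4 * d by rewrite sqr_sqrtr.
exists ((t + q) / 2), ((t - q) / 2); apply: char_poly2; first by rewrite -/t; field.
rewrite -/d; have -> : d = (t ^+ 2 - q ^+ 2) / 4 by rewrite q2; field.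
by field.
Qed.

Lemma exists_principal_curvatures (p : mpoly 2 R) x :
  exists k1 k2, principal_curvatures (poly_fun p) x k1 k2.
Proof.
set f := poly_fun p; apply: eigen_exists.
have [W0 _ W2] := dens f x.
have D : \det (first_form f x) = area_density f x ^+ 2.
  by rewrite det2 !mxE !big_ord1 !mxE /= W2; ring.
apply: (@discr_ge0 (first_form f x) _ (second_form f x)).
- by rewrite !mxE !big_ord1 !mxE mulrC.
- by rewrite !mxE /f !partial_poly_fun mderiv_comm.
- rewrite !mxE !big_ord1 !mxE /= -expr2.
  by rewrite ltr_wpDr ?sqr_ge0 // ltr01.
- by rewrite D exprn_gt0.
- by rewrite mulKVmx // unitmxE D unitfE expf_neq0 // gt_eqF.
Qed.

End Graph.

(* Main.v *)
Require Import Defs.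
From HB Require Import structures.
From mathcomp Require Import all_boot all_order all_algebra.
From mathcomp Require Import all_classical all_reals all_analysis.
From mathcomp Require Import complex polyorder.
From mathcomp Require Import -(notations) mpoly.
From mathcomp Require Import finmap zify ring lra.

Set Implicit Arguments.
Unset Strict Implicit.
Unset Printing Implicit Defensive.

Import Order.TTheory GRing.Theory Num.Theory.
Import numFieldNormedType.Exports.

Local Open Scope classical_set_scope.
Local Open Scope card_scope.
Local Open Scope ring_scope.

(* Let W be the area density, g the gradient and H the Hessian matrix of f. Since W * d_oo lies
   in [1/2, 1], the ratio |k1 - k2| / d_oo tends to 0 exactly when
   W^2 (k1 - k2)^2 = ((tr H + q) / W^2)^2 - 4 det H / W^2 does, where q = g adj(H) g^T. For a
   form of degree n, homogeneity shows that along the ray through a unit vector u this happens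
   iff q vanishes at u and, in case g vanishes there, also (tr H)^2 = 4 det H. Now q is a form of
   degree 3 n - 4; with P = f(X, 1), it dehomogenizes to n P (n P P'' - (n - 1) P'^2). If this is
   zero, then n P - X P' and P' have zero Wronskian, so that n P = (X + l) P' for some l unless P
   is constant, and f is a multiple of a power of a linear form. Otherwise q has at most 3 n - 4
   zeros in [0, pi), and the umbilic directions are invariant under A -> A + pi. *)

Lemma lift0_ord2 : lift 0 0 = 1 :> 'I_2.
Proof. exact/val_inj. Qed.

Lemma sum_ord2 (V : nmodType) (F : 'I_2 -> V) : \sum_i F i = F 0 + F 1.
Proof. by rewrite big_ord_recl big_ord1 lift0_ord2. Qed.

Lemma prod_ord2 (S : pzSemiRingType) (F : 'I_2 -> S) : \prod_i F i = F 0 * F 1.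
Proof. by rewrite big_ord_recl big_ord1 lift0_ord2. Qed.

Lemma row2P (T : Type) (v w : 'rV[T]_2) : v 0 0 = w 0 0 -> v 0 1 = w 0 1 -> v = w.
Proof.
move=> vw0 vw1; apply/rowP => i; case: (unliftP 0 i) => [j ->|-> //].
by rewrite ord1 lift0_ord2.
Qed.

Section MatricesOfSizeTwo.
Context {S : comNzRingType}.
Implicit Types (A H : 'M[S]_2) (g : 'rV[S]_2).

Lemma adj_mx22 A :
  [/\ \adj A 0 0 = A 1 1, \adj A 0 1 = - A 0 1,
      \adj A 1 0 = - A 1 0 & \adj A 1 1 = A 0 0].
Proof.
have lift10 : lift 1 0 = 0 :> 'I_2 by exact/val_inj.
rewrite !mxE /cofactor !det_mx11 !mxE lift0_ord2 lift10 /= !expr0 !expr1 expr2.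
by split; ring.
Qed.

Lemma det_mx22 A : \det A = A 0 0 * A 1 1 - A 0 1 * A 1 0.
Proof.
have [adj00 _ adj10 _] := adj_mx22 A.
have := congr1 (fun B : 'M[S]_2 => B 0 0) (mul_mx_adj A).
by rewrite !mxE sum_ord2 adj00 adj10 /= mulr1n mulrN => <-.
Qed.

Lemma char_poly_mx22 A (k1 k2 : S) :
  char_poly A = ('X - k1%:P) * ('X - k2%:P) -> k1 + k2 = \tr A /\ k1 * k2 = \det A.
Proof.
move=> charA; split; last first.
  have := char_poly_det A; rewrite charA sqrrN expr1n mul1r => <-.
  by rewrite coef0M !coefB !coefX !coefC /= !sub0r mulrNN.
apply: oppr_inj; rewrite -char_poly_trace // charA coefM sum_ord2.
by rewrite !coefB !coefX !coefC /=; ring.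
Qed.

Definition sqnorm g : S := g 0 0 ^+ 2 + g 0 1 ^+ 2.

Lemma sqnormZ (c : S) g : sqnorm (c *: g) = c ^+ 2 * sqnorm g.
Proof. by rewrite /sqnorm !mxE; ring. Qed.

Definition adj_form n (v : 'rV[S]_n) (M : 'M[S]_n) : S := (v *m \adj M *m v^T) 0 0.

Lemma adj_form22 g H :
  adj_form g H
  = g 0 1 ^+ 2 * H 0 0 - g 0 0 * g 0 1 * (H 0 1 + H 1 0) + g 0 0 ^+ 2 * H 1 1.
Proof.
have [adj00 adj01 adj10 adj11] := adj_mx22 H.
rewrite /adj_form mxE sum_ord2 ![g^T _ _]mxE ![(g *m _) _ _]mxE !sum_ord2.
by rewrite adj00 adj01 adj10 adj11; ring.
Qed.

Lemma adj_form22Z (c h : S) g H :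
  adj_form (c *: g) (h *: H) = c ^+ 2 * h * adj_form g H.
Proof. by rewrite !adj_form22 !mxE; ring. Qed.

Lemma det_1D_outer22 g : \det (1%:M + g^T *m g) = 1 + sqnorm g.
Proof. by rewrite det_mx22 !mxE !big_ord1 !mxE /= /sqnorm; ring. Qed.

Lemma mxtrace_adj_1D_outer22 g H :
  \tr (\adj (1%:M + g^T *m g) *m H) = \tr H + adj_form g H.
Proof.
have [adj00 adj01 adj10 adj11] := adj_mx22 (1%:M + g^T *m g).
rewrite /mxtrace !sum_ord2 ![(_ *m H) _ _]mxE !sum_ord2 adj00 adj01 adj10 adj11.
by rewrite adj_form22 !mxE !big_ord1 !mxE /=; ring.
Qed.

Definition parallel (v w : 'rV[S]_2) : bool := v 0 0 * w 0 1 == w 0 0 * v 0 1.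

End MatricesOfSizeTwo.

Lemma map_adj_form (S T : comNzRingType) (f : {rmorphism S -> T}) n
    (g : 'rV[S]_n) (H : 'M[S]_n) :
  f (adj_form g H) = adj_form (map_mx f g) (map_mx f H).
Proof. by rewrite /adj_form -map_mx_adj map_trmx -!map_mxM [in RHS]mxE. Qed.

Lemma sqnorm_ge0 (R : realDomainType) (g : 'rV[R]_2) : 0 <= sqnorm g.
Proof. by rewrite addr_ge0 ?sqr_ge0. Qed.

Lemma sqnorm_eq0 (R : realDomainType) (g : 'rV[R]_2) : (sqnorm g == 0) = (g == 0).
Proof.
rewrite paddr_eq0 ?sqr_ge0 // !sqrf_eq0.
apply/andP/eqP => [[/eqP g0 /eqP g1]|->]; last by rewrite !mxE.
by apply: row2P; rewrite mxE.
Qed.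

Section HomogeneousPolynomials.
Context {k : nat} {S : comNzRingType}.
Implicit Types (p q : mpoly k S) (d : nat).

Lemma dhomog_ind d (P : mpoly k S -> Prop) :
  P 0 -> (forall p q, P p -> P q -> P (p + q)) ->
  (forall c m, mdeg m = d -> P (c *: mpolyX S m)) ->
  forall p, p \is ishomog1 d mdeg -> P p.
Proof.
move=> P0 PD PX p /dhomogP homog_p; rewrite (mpolyE p) big_seq.
by elim/big_ind: _ => // m /homog_p; exact: PX.
Qed.

Lemma dhomog_mderiv d p i :
  p \is ishomog1 d.+1 mdeg -> mderiv i p \is ishomog1 d mdeg.
Proof.
move=> homog_p; apply/dhomogP => m; rewrite mcoeff_msupp mcoeff_deriv => coef_neq0.
apply/eqP; rewrite -eqSS; apply: contra_neqT coef_neq0 => deg_m.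
by rewrite (dhomog_nemf_coeff homog_p) ?mul0rn //= mdegD mdeg1 addn1.
Qed.

Lemma meval_dhomog d p (r : S) (v : 'I_k -> S) : p \is ishomog1 d mdeg ->
  meval (fun i => r * v i) p = r ^+ d * meval v p.
Proof.
elim/dhomog_ind => [|q s IHq IHs|c m <-]; first by rewrite !meval0 mulr0.
  by rewrite !mevalD IHq IHs mulrDr.
rewrite !mevalZ !mevalX mulrCA mdegE -prodrXr -big_split /=.
by congr (_ * _); apply: eq_bigr => i _; rewrite exprMn.
Qed.

Definition gradient_mpoly p : 'rV[mpoly k S]_k := \row_i mderiv i p.

Definition hessian_mpoly p : 'M[mpoly k S]_k := \matrix_(i, j) mderiv i (mderiv j p).

End HomogeneousPolynomials.

Section BinaryForms.
Context {S : comNzRingType}.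
Implicit Types (p : mpoly 2 S) (m : multinom 2) (d : nat).

Lemma mdeg_ord2 m : mdeg m = (m 0%R + m 1%R)%N.
Proof. by rewrite mdegE sum_ord2. Qed.

Definition dehomogenize : mpoly 2 S -> {poly S} :=
  mmap polyC (fun i : 'I_2 => if i == 0 then 'X else 1).

HB.instance Definition _ := GRing.RMorphism.on dehomogenize.

Lemma dehomogenizeZ c p : dehomogenize (c *: p) = c *: dehomogenize p.
Proof. by rewrite /dehomogenize mmapZ mul_polyC. Qed.

Lemma dehomogenizeX m : dehomogenize (mpolyX S m) = 'X^(m 0).
Proof. by rewrite /dehomogenize mmapX /mmap1 prod_ord2 /= expr1n mulr1. Qed.

Lemma size_dehomogenize d p : p \is ishomog1 d mdeg ->
  (size (dehomogenize p) <= d.+1)%N.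
Proof.
elim/(@dhomog_ind 2) => [|q s IHq IHs|c m <-]; first by rewrite rmorph0 size_poly0.
  by rewrite rmorphD (leq_trans (size_polyD _ _)) // geq_max IHq.
rewrite dehomogenizeZ dehomogenizeX (leq_trans (size_scale_leq _ _)) //.
by rewrite size_polyXn mdeg_ord2 ltnS leq_addr.
Qed.

Lemma meval_dehomogenize d p (v : 'I_2 -> S) : p \is ishomog1 d mdeg ->
  meval v p = \sum_(k < d.+1) (dehomogenize p)`_k * (v 0 ^+ k * v 1 ^+ (d - k)).
Proof.
elim/(@dhomog_ind 2) => [|q s IHq IHs|c m deg_m].
- by rewrite meval0 rmorph0 big1 // => k _; rewrite coef0 mul0r.
- rewrite mevalD IHq IHs -big_split; apply: eq_bigr => k _.
  by rewrite rmorphD coefD mulrDl.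
have m0d : (m 0%R < d.+1)%N by rewrite ltnS -deg_m mdeg_ord2 leq_addr.
rewrite dehomogenizeZ dehomogenizeX (bigD1 (Ordinal m0d)) //= big1 => [|k].
  rewrite addr0 coefZ coefXn eqxx mulr1 mevalZ mevalX prod_ord2.
  by rewrite -deg_m mdeg_ord2 addKn.
by rewrite -(inj_eq val_inj) coefZ coefXn => /negPf->; rewrite mulr0 mul0r.
Qed.

Lemma dehomogenize_mderiv0 p : dehomogenize (mderiv 0 p) = (dehomogenize p)^`().
Proof.
elim/mpolyind: p => [|c m p _ _ IHp]; first by rewrite mderiv0 !rmorph0 deriv0.
rewrite mderivD !rmorphD derivD /= IHp mderivZ mderivX !dehomogenizeZ !dehomogenizeX.
by rewrite derivZ derivXn mnmBE mnm1E eqxx subn1 scaler_nat.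
Qed.

Lemma dehomogenize_mderiv1 d p : p \is ishomog1 d mdeg ->
  dehomogenize (mderiv 1 p) = d%:R *: dehomogenize p - 'X * (dehomogenize p)^`().
Proof.
elim/(@dhomog_ind 2) => [|q s IHq IHs|c m <-].
- by rewrite mderiv0 rmorph0 deriv0 scaler0 mulr0 subr0.
- by rewrite mderivD !rmorphD /= IHq IHs derivD scalerDr mulrDr opprD addrACA.
rewrite mderivZ mderivX !dehomogenizeZ !dehomogenizeX derivZ derivXn mnmBE mnm1E subn0.
have -> : 'X * (c *: ('X^((m 0%R).-1) *+ m 0)) = c *: ((m 0)%:R *: 'X^(m 0)) :> {poly S}.
  rewrite -scalerAr mulrnAr scaler_nat; congr (_ *: _).
  by case: (m 0) => [|j]; rewrite ?mulr0n // -exprS.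
rewrite [X in _ = X - _]scalerA mulrC -scalerA -scalerBr -scalerBl mdeg_ord2 natrD.
by rewrite addrAC subrr add0r.
Qed.

Definition level_hessian_mpoly p : mpoly 2 S :=
  adj_form (gradient_mpoly p) (hessian_mpoly p).

Lemma dhomog_level_hessian d p : p \is ishomog1 d.+2 mdeg ->
  level_hessian_mpoly p \is ishomog1 (d.+1 * 2 + d) mdeg.
Proof.
move=> homog_p; rewrite /level_hessian_mpoly adj_form22 !mxE rpredD ?rpredB //.
- by rewrite dhomogM ?dhomogMn ?dhomog_mderiv.
- by rewrite muln2 -addnn !dhomogM ?rpredD ?dhomog_mderiv.
- by rewrite dhomogM ?dhomogMn ?dhomog_mderiv.
Qed.

Lemma dehomogenize_level_hessian d p : p \is ishomog1 d.+2 mdeg ->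
  let P := dehomogenize p in
  dehomogenize (level_hessian_mpoly p) =
    d.+2%:R *: (P * (d.+2%:R *: (P * P^`()^`()) - d.+1%:R *: P^`() ^+ 2)).
Proof.
move=> homog_p P.
have homog_grad i : mderiv i p \is ishomog1 d.+1 mdeg by exact: dhomog_mderiv.
rewrite map_adj_form adj_form22 !mxE /= !dehomogenize_mderiv0.
rewrite !(dehomogenize_mderiv1 (homog_grad _)) (dehomogenize_mderiv1 homog_p).
rewrite dehomogenize_mderiv0 -/P !derivB !derivM !derivZ derivX.
by rewrite -!mul_polyC !polyC_natr -!natr1; ring.
Qed.

End BinaryForms.

Section Wronskian.
Context {R : realFieldType}.
Implicit Types (P Q : {poly R}) (n : nat).

Lemma lead_coef_deriv P : lead_coef P^`() = (size P).-1%:R * lead_coef P.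
Proof.
have [size_le1|] := leqP (size P) 1.
  rewrite (size1_polyC size_le1) derivC lead_coef0 size_polyC.
  by case: (_ != 0); rewrite mul0r.
rewrite !lead_coefE size_deriv coef_deriv mulr_natl.
by case: (size P) => [|[|l]].
Qed.

Lemma wronskian0_proportional P Q : P != 0 -> P^`() * Q = P * Q^`() ->
  exists l, Q = l *: P.
Proof.
move=> P_neq0 wPQ; pose l := Q`_(size P).-1 / lead_coef P; exists l.
apply/eqP; rewrite -subr_eq0; set D := Q - l *: P.
have D_top : D`_(size P).-1 = 0.
  by rewrite coefB coefZ -lead_coefE divfK ?subrr // lead_coef_eq0.
have /(congr1 lead_coef) : P^`() * D = P * D^`().
  by rewrite derivB derivZ !mulrBr wPQ -!scalerAr [P^`() * P]mulrC.
rewrite !lead_coefM !lead_coef_deriv -mulrA mulrCA => /eqP.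
have [//|D_neq0] := eqVneq D 0.
rewrite (inj_eq (mulfI _)) ?lead_coef_eq0 // (inj_eq (mulIf _)) ?lead_coef_eq0 //.
rewrite eqr_nat => /eqP eq_deg; move: D_neq0.
by rewrite -lead_coef_eq0 lead_coefE -eq_deg D_top eqxx.
Qed.

Lemma euler_ode_power n P l : n.+1%:R *: P = ('X + l%:P) * P^`() ->
  exists c, P = c *: ('X + l%:P) ^+ n.+1.
Proof.
move=> odeP; apply: wronskian0_proportional.
  by rewrite expf_neq0 // monic_neq0 // monicXaddC.
rewrite deriv_exp derivD derivX derivC addr0 mul1r exprSr -mulrA -odeP.
by rewrite mulrnAl -scalerAr scaler_nat.
Qed.

Lemma hessian_ode_power n P :
  n.+1%:R *: (P * P^`()^`()) = n%:R *: P^`() ^+ 2 ->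
  exists c a b, P = c *: (a *: 'X + b%:P) ^+ n.+1.
Proof.
move=> ode; have [dP0|dP_neq0] := eqVneq P^`() 0.
  have P_const : (size P <= 1)%N by rewrite -subn_eq0 subn1 -size_deriv dP0 size_poly0.
  exists P`_0, 0, 1; rewrite scale0r add0r expr1n alg_polyC.
  exact: size1_polyC.
have [l Ql] : exists l, n.+1%:R *: P - 'X * P^`() = l *: P^`().
  apply: wronskian0_proportional => //.
  rewrite [LHS]mulrBr -scalerAr [_ * P]mulrC ode derivB derivZ derivM derivX.
  by rewrite -!mul_polyC !polyC_natr -natr1; ring.
have [|c Pc] := @euler_ode_power n P l; last by exists c, 1, l; rewrite scale1r.
by rewrite mulrDl mul_polyC -Ql addrC subrK.
Qed.

End Wronskian.

Section ZerosOfBinaryForms.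
Context {F : fieldType}.
Implicit Types (p : mpoly 2 F) (v w : 'rV[F]_2) (s : seq 'rV[F]_2) (d : nat).

Lemma meval_dehomogenize_slope d p v : p \is ishomog1 d mdeg -> v 0 1 != 0 ->
  meval (v 0) p = v 0 1 ^+ d * (dehomogenize p).[v 0 0 / v 0 1].
Proof.
move=> homog_p v1; rewrite (meval_dehomogenize _ homog_p).
rewrite (horner_coef_wide _ (size_dehomogenize homog_p)) mulr_sumr.
apply: eq_bigr => k _; rewrite [RHS]mulrCA expr_div_n; congr (_ * _).
have -> : v 0 1 ^+ d = v 0 1 ^+ (d - k) * v 0 1 ^+ k by rewrite -exprD subnK // -ltnS.
by rewrite mulrCA mulfK ?expf_neq0.
Qed.

Lemma meval_dehomogenize_top d p v : p \is ishomog1 d mdeg -> v 0 1 = 0 ->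
  meval (v 0) p = (dehomogenize p)`_d * v 0 0 ^+ d.
Proof.
move=> homog_p v1; rewrite (meval_dehomogenize _ homog_p) big_ord_recr big1 /=.
  by rewrite subnn expr0 mulr1 add0r.
by move=> k _; rewrite v1 expr0n subn_eq0 leqNgt ltn_ord !mulr0.
Qed.

Lemma binary_form_affine_zeros d p s : p \is ishomog1 d mdeg ->
  dehomogenize p != 0 -> uniq s ->
  {in s &, forall v w, parallel v w -> v = w} ->
  {in s, forall v, v 0 1 != 0 /\ meval (v 0) p = 0} ->
  (size s < size (dehomogenize p))%N.
Proof.
move=> homog_p p_neq0 uniq_s parallel_inj zeros.
rewrite -(size_map (fun v => v 0 0 / v 0 1)); apply: max_poly_roots => //.
  apply/allP => _ /mapP[v /zeros[v1 pv] ->]; move/eqP: pv.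
  by rewrite (meval_dehomogenize_slope homog_p v1) mulf_eq0 expf_eq0 (negPf v1) andbF.
rewrite map_inj_in_uniq // => v w vs ws /eqP.
by rewrite eqr_div ?(zeros _ vs).1 ?(zeros _ ws).1 //; exact: parallel_inj.
Qed.

Lemma binary_form_zeros d p s : p \is ishomog1 d mdeg ->
  dehomogenize p != 0 -> uniq s ->
  {in s &, forall v w, parallel v w -> v = w} ->
  {in s, forall v, v != 0 /\ meval (v 0) p = 0} ->
  (size s <= d)%N.
Proof.
move=> homog_p p_neq0 uniq_s parallel_inj zeros.
have size_le := size_dehomogenize homog_p.
have [/allP/= affine|] := boolP (all (fun v => v 0 1 != 0) s).
  rewrite -ltnS (leq_trans _ size_le) // (binary_form_affine_zeros homog_p) // => v vs.
  by split; [exact: affine | exact: (zeros _ vs).2].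
(* A zero on the axis [v 0 1 = 0] lowers the degree of the dehomogenization. *)
case/allPn => v vs /negPn/eqP v1.
have [v_neq0 /eqP] := zeros _ vs.
have v0 : v 0 0 != 0.
  by apply: contra_neq v_neq0 => v0; apply: row2P; rewrite mxE.
rewrite (meval_dehomogenize_top homog_p v1) mulf_eq0 expf_eq0 (negPf v0) andbF orbF.
move=> /eqP coef_d.
have size_lt : (size (dehomogenize p) <= d)%N.
  rewrite -ltnS ltn_neqAle size_le andbT; apply: contra_neq p_neq0 => size_eq.
  by apply/eqP; rewrite -lead_coef_eq0 lead_coefE size_eq coef_d.
rewrite (leq_trans _ size_lt) // -(prednK (_ : (0 < size s)%N)); last by case: (s) vs.
rewrite -(size_rem vs) (binary_form_affine_zeros homog_p) ?rem_uniq // => [w1 w2|w].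
  by move=> /mem_rem w1s /mem_rem w2s; exact: parallel_inj.
rewrite mem_rem_uniq // inE => /andP[wv ws]; split; last exact: (zeros _ ws).2.
by apply: contra_neq wv => w1; apply: parallel_inj; rewrite // /parallel w1 v1 !mulr0.
Qed.

End ZerosOfBinaryForms.

Section PowersOfLinearForms.
Context {R : realType}.
Implicit Types (p : mpoly 2 R) (n : nat).

Lemma power_of_linear_form_dehomogenize n p (c a b : R) :
  p \is ishomog1 n mdeg -> dehomogenize p = c *: (a *: 'X + b%:P) ^+ n ->
  power_of_linear_form n (poly_fun p).
Proof.
move=> homog_p pE; exists c, a, b => x.
pose l : mpoly 2 R := a *: mpolyX R (mnm1 0) + b *: mpolyX R (mnm1 1).
have homog_l : c *: l ^+ n \is ishomog1 n mdeg.
  rewrite dhomogZ // -[X in ishomog1 X](mul1n n) dhomogMn //.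
  by rewrite dhomogD // dhomogZ // dhomogX /= mdeg1.
have -> : poly_fun p x = poly_fun (c *: l ^+ n) x.
  rewrite /poly_fun (meval_dehomogenize _ homog_p) (meval_dehomogenize _ homog_l) pE.
  rewrite dehomogenizeZ rmorphXn rmorphD /= !dehomogenizeZ !dehomogenizeX !mnm1E /=.
  by rewrite alg_polyC.
by rewrite /poly_fun mevalZ rmorphXn /= mevalD !mevalZ !mevalXU.
Qed.

Lemma power_of_linear_form_le1 n p : (n <= 1)%N ->
  p \is ishomog1 n mdeg -> power_of_linear_form n (poly_fun p).
Proof.
case: n => [|[|//]] _ homog_p.
  apply: (@power_of_linear_form_dehomogenize _ _ (dehomogenize p)`_0 0 0) => //.
  by rewrite expr0 alg_polyC; apply: size1_polyC; exact: size_dehomogenize homog_p.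
apply: (@power_of_linear_form_dehomogenize _ _ 1 (dehomogenize p)`_1 (dehomogenize p)`_0) => //.
rewrite scale1r expr1; apply/polyP => i; rewrite coefD coefZ coefX coefC.
have := size_dehomogenize homog_p => /leq_sizeP coef0_gt1.
by case: i => [|[|i]]; rewrite ?mulr0 ?add0r ?mulr1 ?addr0 // coef0_gt1.
Qed.

Lemma power_of_linear_form_level_hessian0 n p : p \is ishomog1 n.+2 mdeg ->
  dehomogenize (level_hessian_mpoly p) = 0 -> power_of_linear_form n.+2 (poly_fun p).
Proof.
move=> homog_p; rewrite (dehomogenize_level_hessian homog_p) => /eqP.
rewrite scaler_eq0 pnatr_eq0 /= mulf_eq0 subr_eq0 => /orP[/eqP P0|/eqP ode].
  by apply: (@power_of_linear_form_dehomogenize _ _ 0 0 0) => //; rewrite scale0r.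
have [c [a [b pE]]] := hessian_ode_power ode.
exact: power_of_linear_form_dehomogenize homog_p pE.
Qed.

End PowersOfLinearForms.

Section CardinalityOfRealSets.

Lemma card_bounded_fsubsets (T : choiceType) (A : set T) (K : nat) :
  (forall X : {fset T}, [set` X] `<=` A -> (#|` X| <= K)%N) ->
  exists2 m, A #= `I_m & (m <= K)%N.
Proof.
move=> cardA; have /finite_fsetP[X AX] : finite_set A.
  apply: contrapT => /(@infinite_set_fset _ _ K.+1)[X /cardA XK].
  by rewrite ltnNge XK.
by exists #|` X|; [rewrite AX; exact/card_eq_fsetP | apply: cardA; rewrite AX].
Qed.

Lemma card_two_periods (R : realDomainType) (T : R) (B : set R) (m : nat) :
  (forall a, B (a + T) <-> B a) ->
  [set a | 0 <= a < T /\ B a] #= `I_m ->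
  [set a | 0 <= a < 2 * T /\ B a] #= `I_m.*2.
Proof.
move=> BT cardB; have /finite_fsetP[X BX] : finite_set [set a | 0 <= a < T /\ B a].
  by apply/finite_setP; exists m.
have XP a : a \in X <-> 0 <= a < T /\ B a.
  by rewrite -[_ /\ _]/([set a | 0 <= a < T /\ B a] a) BX.
pose Y : {fset R} := [fset (a + T)%R | a in X]%fset.
have YP a : a \in Y <-> T <= a < 2 * T /\ B a.
  split=> [/imfsetP[c /= /XP[cT Bc] ->]|[aT Ba]].
    by split; [lra | exact/BT].
  apply/imfsetP; exists (a - T) => /=; last by rewrite subrK.
  by apply/XP; split; [lra | apply/BT; rewrite subrK].
have -> : [set a | 0 <= a < 2 * T /\ B a] = [set` (X `|` Y)%fset].
  apply/seteqP; split=> a /=; rewrite in_fsetU.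
    move=> [aT Ba]; apply/orP; have [Ta|Ta] := ltP a T.
      by left; apply/XP; split=> //; lra.
    by right; apply/YP; split=> //; lra.
  by move=> /orP[/XP|/YP] [aT Ba]; split=> //; lra.
apply/card_eq_fsetP; rewrite -addnn.
have XY0 : (X `&` Y = fset0)%fset.
  apply/fsetP => a; rewrite in_fsetI in_fset0.
  apply/negP => /andP[/XP[/andP[_ aT] _] /YP[/andP[Ta _] _]].
  by have := lt_le_trans aT Ta; rewrite ltxx.
have cardX : #|` X| = m by apply/card_eq_fsetP; rewrite -BX.
by rewrite cardfsU XY0 cardfs0 subn0 card_imfset ?cardX //; exact: addIr.
Qed.

End CardinalityOfRealSets.

Section Curvature.
Context {R : realType}.
Implicit Types (f : 'rV[R]_2 -> R) (x : 'rV[R]_2).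

(* Up to sign, [|grad f|^3] times the curvature of the level curve of [f] through [x]. *)
Definition level_hessian f x : R := adj_form (grad f x) (hess f x).

Lemma area_densityE f x : area_density f x = Num.sqrt (1 + sqnorm (grad f x)).
Proof. by rewrite /sqnorm !mxE addrA. Qed.

Lemma area_density_sqr f x : area_density f x ^+ 2 = 1 + sqnorm (grad f x).
Proof. by rewrite area_densityE sqr_sqrtr // addr_ge0 // sqnorm_ge0. Qed.

Lemma area_density_gt0 f x : 0 < area_density f x.
Proof. by rewrite area_densityE sqrtr_gt0 ltr_pwDl // sqnorm_ge0. Qed.

Lemma principal_curvatures_sum_prod f x k1 k2 : principal_curvatures f x k1 k2 ->
  (k1 + k2) * area_density f x ^+ 3 = \tr (hess f x) + level_hessian f x /\
  k1 * k2 * area_density f x ^+ 4 = \det (hess f x).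
Proof.
have W_neq0 : area_density f x != 0 by rewrite gt_eqF // area_density_gt0.
have detG : \det (first_form f x) = area_density f x ^+ 2.
  by rewrite det_1D_outer22 area_density_sqr.
have Gu : first_form f x \in unitmx by rewrite unitmxE detG unitrX // unitfE.
move=> /char_poly_mx22 [-> ->]; split.
  rewrite /shape_operator /invmx Gu -scalemxAr -scalemxAl !mxtraceZ.
  by rewrite mxtrace_adj_1D_outer22 detG -/(level_hessian f x); field.
by rewrite det_mulmx det_inv detG detZ; field.
Qed.

Definition curvature_gap_sqr f x : R :=
  let w := 1 + sqnorm (grad f x) in
  ((\tr (hess f x) + level_hessian f x) / w) ^+ 2 - 4 * \det (hess f x) / w.

Lemma curvature_gap_sqrE f x k1 k2 : principal_curvatures f x k1 k2 ->
  curvature_gap_sqr f x = (area_density f x * (k1 - k2)) ^+ 2.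
Proof.
move=> /principal_curvatures_sum_prod [sum_k prod_k].
rewrite /curvature_gap_sqr -sum_k -prod_k -area_density_sqr; field.
by rewrite gt_eqF // area_density_gt0.
Qed.

Lemma gauss_coordinate_normc f x xi : gauss_coordinate f x xi ->
  let rho := ComplexField.Normc.normc xi in
  [/\ 0 <= rho, rho < 1 & area_density f x = (1 + rho ^+ 2) / (1 - rho ^+ 2)].
Proof.
move=> gauss rho; split.
- by rewrite /rho; case: (xi) => a b; exact: sqrtr_ge0.
- exact: ((gauss_coordinateP f x xi).1 gauss).1.
have [_ ver] := gauss.
suff: (area_density f x)^-1 = (1 - rho ^+ 2) / (1 + rho ^+ 2).
  by move=> W_inv; rewrite -[LHS]invrK W_inv invf_div.
apply: (@complexI R); rewrite -[LHS]ver -sqr_normc.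
by rewrite !(rmorphB, rmorphD, rmorphM, fmorphV, rmorph1, rmorphXn).
Qed.

Lemma area_density_dist_infty f x xi : gauss_coordinate f x xi ->
  0 < dist_infty xi /\ 1 / 2 <= area_density f x * dist_infty xi <= 1.
Proof.
move=> /gauss_coordinate_normc; rewrite /dist_infty.
set rho := ComplexField.Normc.normc _ => -[rho0 rho1 ->].
have -> : (1 + rho ^+ 2) / (1 - rho ^+ 2) * (1 - rho) = (1 + rho ^+ 2) / (1 + rho).
  by field; rewrite !gt_eqF //; nra.
by rewrite ler_pdivlMr ?ler_pdivrMr; [split; [lra | nra]|lra|lra].
Qed.

End Curvature.

Section ConvergenceToZero.
Context {R : realType} {T : Type} {G : set_system T} {FG : ProperFilter G}.
Implicit Types (X Y : T -> R) (C : R).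

Lemma cvg0_comparable X Y C :
  (\forall t \near G, `|X t| <= `|Y t| <= C * `|X t|) ->
  X @ G --> (0 : R) <-> Y @ G --> (0 : R).
Proof.
move=> XY; split=> [X0|Y0]; apply: norm_cvg0.
  have CX0 : C * `|X t| @[t --> G] --> (0 : R).
    by rewrite -(mulr0 C) -(normr0 R); apply: cvgMr; exact: cvg_norm.
  apply: squeeze_cvgr (cvg_cst 0) CX0.
  by apply: filterS XY => t /andP[_ ->]; rewrite normr_ge0.
have absY0 : `|Y t| @[t --> G] --> (0 : R) by rewrite -(normr0 R); exact: cvg_norm.
apply: squeeze_cvgr (cvg_cst 0) absY0.
by apply: filterS XY => t /andP[-> _]; rewrite normr_ge0.
Qed.

Lemma cvg0_sqr X : (X t ^+ 2 @[t --> G] --> (0 : R)) <-> X @ G --> (0 : R).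
Proof.
split=> X0; last by rewrite -(mulr0 (0 : R)); apply: cvgM.
apply: norm_cvg0; rewrite -(sqrtr0 R).
under eq_cvg do rewrite -sqrtr_sqr.
exact: (continuous_cvg _ (@sqrt_continuous R 0) X0).
Qed.

Lemma cvg0_addr X Y : Y @ G --> (0 : R) ->
  (X t + Y t @[t --> G] --> (0 : R)) <-> X @ G --> (0 : R).
Proof.
move=> Y0; split=> [XY0|X0]; last by rewrite -(addr0 (0 : R)); exact: cvgD.
have -> : X = (fun t => X t + Y t - Y t) by apply/funext => t; rewrite addrK.
by rewrite -(subr0 (0 : R)); apply: cvgB.
Qed.

Lemma cvg0_le_norm X C :
  X @ G --> (0 : R) -> (\forall t \near G, C <= `|X t|) -> C <= 0.
Proof. by move=> X0; apply: cvgr_to_ge; rewrite -(normr0 R); exact: cvg_norm. Qed.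

End ConvergenceToZero.

Section CurvatureGapAlongRays.
Context {R : realType}.
Implicit Types (n : nat) (s T D q r : R).

Definition ray_density n s r : R := 1 + r ^+ n.+1 ^+ 2 * s.

Lemma ray_density_gt0 n s r : 0 <= s -> 0 < ray_density n s r.
Proof. by move=> s0; rewrite ltr_pwDl // mulr_ge0 ?sqr_ge0. Qed.

Lemma cvg_sqr_over_ray_density n s : 0 < s ->
  r ^+ n ^+ 2 / ray_density n s r @[r --> +oo] --> (0 : R).
Proof.
move=> s0; have inv_cvg0 : s^-1 * r^-1 @[r --> +oo] --> (0 : R).
  rewrite -(mulr0 s^-1); apply: cvgMr; apply/gtr0_cvgV0; last exact: cvg_id.
  exact: nbhs_pinfty_gt.
apply: squeeze_cvgr (cvg_cst 0) inv_cvg0; near=> r.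
have r1 : 1 <= r by near: r; exact: nbhs_pinfty_ge.
have w0 : 0 < ray_density n s r by rewrite ray_density_gt0 // ltW.
have sr0 : 0 < s * r by rewrite mulr_gt0 //; lra.
have w_ge : r ^+ n ^+ 2 * (s * r) <= ray_density n s r.
  have -> : ray_density n s r = r ^+ n ^+ 2 * (s * r) * r + 1.
    by rewrite /ray_density [r ^+ n.+1]exprS; ring.
  by rewrite ler_wpDr // ler_peMr // mulr_ge0 ?sqr_ge0 // ltW.
by rewrite divr_ge0 ?sqr_ge0 ?(ltW w0) //= -invfM ler_pdivrMr // mulrC ler_pdivlMr.
Unshelve. all: by end_near. Qed.

Lemma cvg_over_ray_density n s : 0 < s ->
  r ^+ n / ray_density n s r @[r --> +oo] --> (0 : R).
Proof.
move=> s0; apply: squeeze_cvgr (cvg_cst 0) (cvg_sqr_over_ray_density n s0); near=> r.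
have r1 : 1 <= r by near: r; exact: nbhs_pinfty_ge.
have rn1 : 1 <= r ^+ n by rewrite exprn_ege1.
have rn0 : 0 <= r ^+ n by lra.
have w0 : 0 < ray_density n s r by rewrite ray_density_gt0 // ltW.
by rewrite divr_ge0 ?(ltW w0) //= ler_pM2r ?invr_gt0 // expr2 ler_peMl.
Unshelve. all: by end_near. Qed.

Lemma level_coef_over_ray_density_ge n s r : 0 <= s -> 1 <= r ->
  (1 + s)^-1 <= r ^+ n.+1 ^+ 2 * r ^+ n / ray_density n s r.
Proof.
move=> s0 r1; have s1 : 0 < 1 + s by lra.
have sqr_ge1 : 1 <= r ^+ n.+1 ^+ 2 by rewrite !exprn_ege1.
have w_le : ray_density n s r <= r ^+ n.+1 ^+ 2 * (1 + s).
  by rewrite mulrDr mulr1 lerD2r.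
rewrite ler_pdivlMr ?ray_density_gt0 // mulrC ler_pdivrMr // (le_trans w_le) //.
by rewrite ler_pM2r // ler_peMr ?exprn_ege1 // sqr_ge0.
Qed.

(* [T], [D], [q] and [s] stand for the values on the unit circle of the trace and determinant
   of the Hessian, of the level Hessian and of the squared norm of the gradient of a form of
   degree [n + 2]. *)
Definition curvature_gap_ray n T D q s r : R :=
  ((r ^+ n * T + r ^+ n.+1 ^+ 2 * r ^+ n * q) / ray_density n s r) ^+ 2
  - 4 * (r ^+ n ^+ 2 * D) / ray_density n s r.

Lemma curvature_gap_ray_critical n T D :
  curvature_gap_ray n T D 0 0 r @[r --> +oo] --> (0 : R) <-> T ^+ 2 = 4 * D.
Proof.
have gapE r : curvature_gap_ray n T D 0 0 r = r ^+ n ^+ 2 * (T ^+ 2 - 4 * D).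
  by rewrite /curvature_gap_ray /ray_density !mulr0 !addr0 !divr1; ring.
split=> [gap0|TD]; last first.
  by under eq_cvg do rewrite gapE TD subrr mulr0; exact: cvg_cst.
apply/eqP; rewrite -subr_eq0 -normr_le0.
apply: cvg0_le_norm gap0 _; near=> r.
have r1 : 1 <= r by near: r; exact: nbhs_pinfty_ge.
by rewrite gapE normrM ler_peMl // ger0_norm ?sqr_ge0 // !exprn_ege1.
Unshelve. all: by end_near. Qed.

Lemma curvature_gap_ray_regular n T D q s : 0 < s ->
  curvature_gap_ray n T D q s r @[r --> +oo] --> (0 : R) <-> q = 0.
Proof.
move=> s0; pose w := ray_density n s.
have trace_cvg0 : r ^+ n / w r * T @[r --> +oo] --> (0 : R).
  by rewrite -(mul0r T); apply: cvgMl; exact: cvg_over_ray_density.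
have det_cvg0 : - (4 * D) * (r ^+ n ^+ 2 / w r) @[r --> +oo] --> (0 : R).
  by rewrite -(mulr0 (- (4 * D))); apply: cvgMr; exact: cvg_sqr_over_ray_density.
pose level r := r ^+ n.+1 ^+ 2 * r ^+ n / w r * q.
pose mean r := level r + r ^+ n / w r * T.
have -> : curvature_gap_ray n T D q s =
    fun r => mean r ^+ 2 + - (4 * D) * (r ^+ n ^+ 2 / w r).
  by apply/funext => r; rewrite /curvature_gap_ray /mean /level /w; ring.
apply: iff_trans (cvg0_addr (fun r => mean r ^+ 2) det_cvg0) _.
apply: iff_trans (cvg0_sqr _) _.
apply: iff_trans (cvg0_addr level trace_cvg0) _.
split=> [level_cvg0|q0]; last first.
  have -> : level = cst 0 by apply/funext => r; rewrite /level q0 mulr0.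
  exact: cvg_cst.
apply/eqP; rewrite -normr_le0 -(pmulr_rle0 _ (_ : 0 < (1 + s)^-1)) ?invr_gt0 ?addr_gt0 //.
apply: cvg0_le_norm level_cvg0 _; near=> r.
have r1 : 1 <= r by near: r; exact: nbhs_pinfty_ge.
rewrite normrM ler_wpM2r // (le_trans _ (ler_norm _)) //.
exact: level_coef_over_ray_density_ge (ltW s0) r1.
Unshelve. all: by end_near. Qed.

End CurvatureGapAlongRays.

Section UmbilicDirections.
Context {R : realType}.
Implicit Types (f : 'rV[R]_2 -> R) (p : mpoly 2 R) (x u : 'rV[R]_2) (n : nat).

Lemma umbilic_at_infinity_curvature_gap f (k1 k2 : 'rV[R]_2 -> R)
    (xi : 'rV[R]_2 -> R[i]) (A : R) :
  (forall x, principal_curvatures f x (k1 x) (k2 x)) ->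
  (forall x, gauss_coordinate f x (xi x)) ->
  umbilic_at_infinity k1 k2 xi A <->
  (curvature_gap_sqr f (polar r A) @[r --> +oo] --> (0 : R)).
Proof.
move=> curv gauss.
pose gap r := area_density f (polar r A) * (k1 (polar r A) - k2 (polar r A)).
have -> : (fun r => curvature_gap_sqr f (polar r A)) = (fun r => gap r ^+ 2).
  by apply/funext => r; exact: curvature_gap_sqrE.
apply: iff_trans _ (iff_sym (cvg0_sqr _)); apply: iff_sym.
apply: (cvg0_comparable (C := 2)); apply: nearW => r.
have [d0 /andP[Wd_ge Wd_le]] := area_density_dist_infty (gauss (polar r A)).
rewrite /gap; set W := area_density _ _ in Wd_ge Wd_le *.
have W0 : 0 < W := area_density_gt0 _ _.
set d := dist_infty _ in d0 Wd_ge Wd_le *; set k := k1 _ - k2 _.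
rewrite normrM (gtr0_norm W0) normrM normr_id normfV (gtr0_norm d0).
have := ler_wpM2l (normr_ge0 k) Wd_ge; have := ler_wpM2l (normr_ge0 k) Wd_le.
by rewrite ler_pdivlMr // ler_pdivrMr //; lra.
Qed.

Definition umbilic_direction f u : bool :=
  (level_hessian f u == 0) &&
  ((grad f u == 0) ==> (\tr (hess f u) ^+ 2 == 4 * \det (hess f u))).

Lemma grad_poly_fun p x :
  grad (poly_fun p) x = map_mx (meval (x 0)) (gradient_mpoly p).
Proof. by apply/rowP => i; rewrite !mxE partial_poly_fun. Qed.

Lemma hess_poly_fun p x :
  hess (poly_fun p) x = map_mx (meval (x 0)) (hessian_mpoly p).
Proof. by apply/matrixP => i j; rewrite !mxE !partial_poly_fun. Qed.

Lemma level_hessian_poly_fun p x :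
  level_hessian (poly_fun p) x = poly_fun (level_hessian_mpoly p) x.
Proof. by rewrite /level_hessian grad_poly_fun hess_poly_fun -map_adj_form. Qed.

Lemma poly_funZ n p (r : R) x : p \is ishomog1 n mdeg ->
  poly_fun p (r *: x) = r ^+ n * poly_fun p x.
Proof.
by move=> homog_p; rewrite -(meval_dhomog _ _ homog_p); apply: meval_eq => i; rewrite mxE.
Qed.

Lemma grad_poly_funZ n p (r : R) x : p \is ishomog1 n.+1 mdeg ->
  grad (poly_fun p) (r *: x) = r ^+ n *: grad (poly_fun p) x.
Proof.
move=> homog_p; apply/rowP => i; rewrite !mxE !partial_poly_fun.
by rewrite (poly_funZ _ _ (dhomog_mderiv i homog_p)).
Qed.

Lemma hess_poly_funZ n p (r : R) x : p \is ishomog1 n.+2 mdeg ->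
  hess (poly_fun p) (r *: x) = r ^+ n *: hess (poly_fun p) x.
Proof.
move=> homog_p; apply/matrixP => i j; rewrite !mxE !partial_poly_fun.
by rewrite (poly_funZ _ _ (dhomog_mderiv i (dhomog_mderiv j homog_p))).
Qed.

Lemma polarE (r A : R) : polar r A = r *: polar 1 A.
Proof. by apply/rowP => i; rewrite !mxE; case: ifP => _; rewrite mul1r. Qed.

Lemma polarDpi (A : R) : polar 1 (A + pi) = -1 *: polar 1 A.
Proof.
by apply/rowP => i; rewrite !mxE cosDpi sinDpi; case: ifP => _; rewrite !mul1r mulN1r.
Qed.

Lemma curvature_gap_sqr_polar n p (r A : R) : p \is ishomog1 n.+2 mdeg ->
  let f := poly_fun p in let u := polar 1 A in
  curvature_gap_sqr f (polar r A) =
  curvature_gap_ray n (\tr (hess f u)) (\det (hess f u)) (level_hessian f u)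
    (sqnorm (grad f u)) r.
Proof.
move=> homog_p f u; rewrite /curvature_gap_sqr /level_hessian polarE.
rewrite (grad_poly_funZ _ _ homog_p) (hess_poly_funZ _ _ homog_p).
by rewrite adj_form22Z sqnormZ mxtraceZ detZ.
Qed.

Lemma umbilic_at_infinity_direction n p (k1 k2 : 'rV[R]_2 -> R)
    (xi : 'rV[R]_2 -> R[i]) (A : R) : p \is ishomog1 n.+2 mdeg ->
  (forall x, principal_curvatures (poly_fun p) x (k1 x) (k2 x)) ->
  (forall x, gauss_coordinate (poly_fun p) x (xi x)) ->
  umbilic_at_infinity k1 k2 xi A <-> umbilic_direction (poly_fun p) (polar 1 A).
Proof.
move=> homog_p curv gauss.
apply: iff_trans (umbilic_at_infinity_curvature_gap A curv gauss) _.
under eq_cvg do rewrite (curvature_gap_sqr_polar _ _ homog_p).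
rewrite /umbilic_direction.
have [grad0|grad_neq0] := eqVneq (grad (poly_fun p) (polar 1 A)) 0; last first.
  have s_gt0 : 0 < sqnorm (grad (poly_fun p) (polar 1 A)).
    by rewrite lt_neqAle eq_sym sqnorm_eq0 grad_neq0 sqnorm_ge0.
  by rewrite andbT; apply: iff_trans (curvature_gap_ray_regular _ _ _ _ s_gt0) (rwP eqP).
have -> : level_hessian (poly_fun p) (polar 1 A) = 0.
  by rewrite /level_hessian grad0 /adj_form !mul0mx mxE.
have -> : sqnorm (grad (poly_fun p) (polar 1 A)) = 0.
  by apply/eqP; rewrite sqnorm_eq0 grad0.
by rewrite eqxx; apply: iff_trans (curvature_gap_ray_critical _ _ _) (rwP eqP).
Qed.

Lemma umbilic_directionZ n p (r : R) u : r != 0 -> p \is ishomog1 n.+2 mdeg ->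
  umbilic_direction (poly_fun p) (r *: u) = umbilic_direction (poly_fun p) u.
Proof.
move=> r_neq0 homog_p; rewrite /umbilic_direction /level_hessian.
rewrite (grad_poly_funZ _ _ homog_p) (hess_poly_funZ _ _ homog_p) adj_form22Z mxtraceZ detZ.
rewrite exprMn [4 * (_ * _)]mulrCA [r ^+ n.+1 *: _ == 0]scaler_eq0.
by rewrite !mulf_eq0 !expf_eq0 (negPf r_neq0) !andbF (inj_eq (mulfI _)) ?expf_neq0.
Qed.

Lemma sin_eq0_pi (t : R) : - pi < t < pi -> sin t = 0 -> t = 0.
Proof.
move=> /andP[t_gt t_lt] sint0; have [t0|t0|//] := ltgtP t 0.
  have : 0 < sin (- t) by apply: sin_gt0_pi; lra.
  by rewrite sinN sint0 oppr0 ltxx.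
have : 0 < sin t by apply: sin_gt0_pi; lra.
by rewrite sint0 ltxx.
Qed.

Lemma parallel_polar_inj (A B : R) : 0 <= A < pi -> 0 <= B < pi ->
  parallel (polar 1 A) (polar 1 B) -> A = B.
Proof.
move=> A_pi B_pi; rewrite /parallel !mxE /= !mul1r => /eqP AB.
apply/eqP; rewrite -subr_eq0; apply/eqP/sin_eq0_pi; first lra.
by rewrite sinB AB; ring.
Qed.

Lemma polar1_neq0 (A : R) : polar 1 A != 0.
Proof.
by rewrite -sqnorm_eq0 /sqnorm !mxE /= !mul1r cos2Dsin2 oner_neq0.
Qed.

Lemma card_binary_form_zero_angles n p (X : {fset R}) : p \is ishomog1 n mdeg ->
  dehomogenize p != 0 ->
  (forall A, A \in X -> 0 <= A < pi /\ poly_fun p (polar 1 A) = 0) ->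
  (#|` X| <= n)%N.
Proof.
move=> homog_p p_neq0 zeros.
have polarI A B : A \in X -> B \in X -> parallel (polar 1 A) (polar 1 B) -> A = B.
  by move=> /zeros[A_pi _] /zeros[B_pi _]; exact: parallel_polar_inj.
rewrite -(size_map (polar 1)); apply: (binary_form_zeros homog_p) => //.
- rewrite map_inj_in_uniq ?fset_uniq // => A B AX BX AB.
  by apply: polarI => //; rewrite /parallel AB.
- by move=> _ _ /mapP[A AX ->] /mapP[B BX ->] /polarI ->.
- by move=> _ /mapP[A /zeros[_ pA] ->]; rewrite polar1_neq0.
Qed.

End UmbilicDirections.

Theorem theorem1 (R : realType) (n : nat) (p : mpoly 2 R)
    (k1 k2 : 'rV[R]_2 -> R) (xi : 'rV[R]_2 -> R[i])
    (hp : p \is ishomog1 n mdeg)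
    (hlin : ~ power_of_linear_form n (poly_fun p))
    (hk : forall x, principal_curvatures (poly_fun p) x (k1 x) (k2 x))
    (hxi : forall x, gauss_coordinate (poly_fun p) x (xi x)) :
  exists m : nat,
    [/\ [set A : R | 0 <= A < 2 * pi /\ umbilic_at_infinity k1 k2 xi A]
          #= `I_m,
        ~~ odd m & (m + 8 <= 6 * n)%N].
Proof.
have [n_le1|] := leqP n 1.
  by case: hlin; exact: power_of_linear_form_le1.
case: n hp hlin => [|[|n]] // hp hlin _.
have umbilicE A := umbilic_at_infinity_direction A hp hk hxi.
have q_neq0 : dehomogenize (level_hessian_mpoly p) != 0.
  by apply/eqP => /(power_of_linear_form_level_hessian0 hp).
have [X sub_X|m card_m m_le] := @card_bounded_fsubsets R
    [set A | 0 <= A < pi /\ umbilic_at_infinity k1 k2 xi A] (n.+1 * 2 + n).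
  apply: (card_binary_form_zero_angles (dhomog_level_hessian hp) q_neq0) => A /sub_X[A_pi].
  by move=> /umbilicE/andP[/eqP qA _]; rewrite -level_hessian_poly_fun.
exists m.*2; split; [|by rewrite odd_double|by lia].
apply: card_two_periods => // A.
have neg1 : -1 != 0 :> R by rewrite oppr_eq0 oner_eq0.
split=> [/umbilicE|/umbilicE uA]; last apply/umbilicE.
  by rewrite polarDpi (umbilic_directionZ _ neg1 hp) => /umbilicE.
by rewrite polarDpi (umbilic_directionZ _ neg1 hp).
Qed.
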